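(* Let $\rho_n=\chi_n\ln n$, where $0<\rho_n<n$ and $\chi_n\to\infty$ as $n\to\infty$. Then $$P\left(\lim_{n\to\infty}\frac{b_1^{(n,\rho_n)}}{\rho_n}=1\right)=1.$$
   Context: For each (sufficiently large) $n$, $\{a_{ij}^{(n,\rho_n)}\}_{1\le i<j\le n}$ are jointly independent Bernoulli random variables equal to $1$ with probability $\rho_n/n$ and to $0$ with probability $1-\rho_n/n$; they are extended by symmetry $a_{ji}=a_{ij}$ and $a_{ii}=0$, giving the adjacency matrix of the Erdős–Rényi random graph. All these variables, for all $n$, form a triangular array defined on one probability space. The degree of vertex $i$ is $b_i^{(n,\rho_n)}=\sum_{l=1}^n a_{il}^{(n,\rho_n)}$. *)

(* Defs.v *)
From mathcomp Require Import all_boot all_order all_algebra finmap.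
From mathcomp Require Import all_classical all_reals all_analysis.

Set Implicit Arguments.
Unset Strict Implicit.
Unset Printing Implicit Defensive.

Import Order.TTheory GRing.Theory Num.Theory.
Import numFieldNormedType.Exports.

Local Open Scope classical_set_scope.
Local Open Scope ring_scope.

Section Defs.
Context (d : measure_display) (T : measurableType d) (R : realType)
        (P : probability T R).

Definition mutually_independent (I : choiceType) (D : set I)
    (X : I -> {RV P >-> R}) : Prop :=
  forall (J : {fset I}) (B : I -> set R),
    [set` J] `<=` D -> (forall i, i \in J -> measurable (B i)) ->
    P (\bigcap_(i in [set` J]) (X i @^-1` B i)) =
    (\prod_(i <- J) P (X i @^-1` B i))%E.

Definition bernoulli_RV (p : R) (X : {RV P >-> R}) : Prop :=
  P (X @^-1` [set 1]) = p%:E /\ P (X @^-1` [set 0]) = (1 - p)%:E.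

(* Vertices are numbered 1, ..., n; entries of [a] with an index outside this
   range are unconstrained and never used. *)
Record erdos_renyi (n : nat) (p : R) (a : nat -> nat -> {RV P >-> R}) : Prop :=
  ErdosRenyi {
    er_indep : mutually_independent
      [set ij : nat * nat | [/\ 1 <= ij.1, ij.1 < ij.2 & ij.2 <= n]%N]
      (fun ij => a ij.1 ij.2);
    er_bernoulli : forall i j : nat, (1 <= i)%N -> (i < j)%N -> (j <= n)%N ->
      bernoulli_RV p (a i j);
    er_sym : forall i j : nat, (1 <= i <= n)%N -> (1 <= j <= n)%N ->
      forall w, a j i w = a i j w;
    er_diag : forall i : nat, (1 <= i <= n)%N -> forall w, a i i w = 0 }.

Definition degree (n : nat) (a : nat -> nat -> {RV P >-> R}) (i : nat) (w : T) : R :=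
  \sum_(1 <= l < n.+1) a i l w.

End Defs.

(* Main.v *)
Require Import Defs.
From mathcomp Require Import all_boot all_order all_algebra finmap.
From mathcomp Require Import all_classical all_reals all_analysis.
From mathcomp Require Import measurable_realfun.
From mathcomp Require Import ring lra.

Import Order.TTheory GRing.Theory Num.Theory.
Import numFieldNormedType.Exports.

Local Open Scope classical_set_scope.
Local Open Scope ring_scope.

(** The degree of vertex 1 is a sum of [n - 1] independent Bernoulli variables of
    parameter [rho n / n], so the exponential Markov inequality at the points
    [t = e/4] and [t = -e/4] bounds the probability that [degree / rho n] is at
    distance at least [e] from 1 by [2 exp (1 - e^2 rho n / 8)].  Since
    [rho n = chi n * ln n] and [chi n] eventually exceeds [16 / e^2], this is
    [O(n^-2)], hence summable, and the Borel-Cantelli lemma applies for every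
    [e]. *)

(** * Elementary estimates for the exponential and for inverse squares *)

(** From [1 - t <= expR (- t)] comes [expR t <= 1 / (1 - t)], and [(1 + t + 2 t^2) (1 - t) - 1 = t^2
    (1 - 2 t)] is nonnegative for [t <= 1/2]. *)
Lemma expR_le_quadratic (R : realType) (t : R) :
  t <= 2^-1 -> expR t <= 1 + t + 2 * t ^+ 2.
Proof.
move=> t_le; have t_lt1 : 0 < 1 - t by lra.
have h1 : 1 - t <= expR (- t) by exact: expR_ge1Dx.
have e0 : 0 < expR t by exact: expR_gt0.
have e1 : expR t * (1 - t) <= 1.
  by rewrite -[leRHS](expRxMexpNx_1 t) ler_pM2l.
rewrite -(ler_pM2r t_lt1); apply: (le_trans e1).
rewrite -subr_ge0.
have -> : (1 + t + 2 * t ^+ 2) * (1 - t) - 1 = t ^+ 2 * (1 - 2 * t) by ring.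
by rewrite mulr_ge0 ?sqr_ge0//; lra.
Qed.

Lemma inv_sqr_series_lty (R : realType) (C : R) (u : nat -> \bar R) :
  (forall n, 0 <= u n)%E -> (forall n, u n <= (C * n.+1%:R ^- 2)%:E)%E ->
  (\sum_(0 <= n <oo) u n < +oo)%E.
Proof.
move=> u0 uC.
have C0 : 0 <= C.
  by have := le_trans (u0 0%N) (uC 0%N); rewrite lee_fin expr1n invr1 mulr1.
have sumC n : (\sum_(0 <= k < n) (C * k.+1%:R ^- 2)%:E <= (2 * C)%:E)%E.
  rewrite sumEFin lee_fin -mulr_sumr mulrC ler_wpM2r//.
  (* This sharper bound survives induction: with [x = n + 1] it grows by [2 / (x (x + 1))], at least
     [1 / x^2] as [x >= 1]. *)
  suff : \sum_(0 <= k < n) k.+1%:R ^- 2 <= 2 - 2 / n.+1%:R :> R.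
    by move/le_trans; apply; rewrite gerBl divr_ge0.
  elim: n => [|n ih]; first by rewrite big_geq// divr1 subrr.
  rewrite big_nat_recr//= (le_trans (lerD ih (lexx _)))//.
  have : 1 <= n.+1%:R :> R by rewrite ler1n.
  rewrite -[in X in _ <= _ - _ / X]natr1; move: (n.+1%:R : R) => x x1.
  have x0 : x != 0 by lra.
  have x10 : x + 1 != 0 by lra.
  rewrite -subr_ge0.
  have -> : 2 - 2 / (x + 1) - (2 - 2 / x + x ^- 2) =
    (x - 1) / (x ^+ 2 * (x + 1)) by field; rewrite x0 x10.
  by rewrite divr_ge0// ?mulr_ge0 ?sqr_ge0//; lra.
apply: (@le_lt_trans _ _ (2 * C)%:E); last exact: ltry.
apply: lime_le; first exact: is_cvg_nneseries.
by apply: nearW => n; apply: le_trans (sumC n); exact: lee_sum.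
Qed.

(** * Almost sure convergence from summable deviation probabilities *)

Section almost_sure_convergence.
Context (d : measure_display) (T : measurableType d) (R : realType).
Context (P : probability T R).
Variables (Y : nat -> T -> R) (l : R).
Hypothesis mY : forall n, measurable_fun setT (Y n).

Lemma measurable_deviation (e : R) n :
  measurable [set w | e <= `|Y n w - l|].
Proof.
have mYl : measurable_fun setT (fun w => `|Y n w - l|).
  by apply: measurableT_comp => //; exact: measurable_funB.
by rewrite -[X in measurable X]setTI; exact: measurable_fun_le.
Qed.

(** The thresholds [1 / (k + 1)] suffice to test convergence, so its failure is a countable union of
    limsup events, each open to Borel-Cantelli. *)
Lemma cvg_setE : [set w | Y n w @[n --> \oo] --> l] =
  ~` \bigcup_k lim_sup_set (fun n => [set w | k.+1%:R^-1 <= `|Y n w - l|]).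
Proof.
apply/seteqP; split => w /=.
  move=> /cvgrPdist_lt Yl [k _ limsup].
  have /Yl[N _ YN] : 0 < k.+1%:R^-1 :> R by rewrite invr_gt0.
  have [n Nn /=] := limsup N I.
  by have := YN _ Nn; rewrite /= distrC ltNge => /negP.
move=> nlimsup; apply/cvgrPdist_lt => e e0.
have [k _ /(_ k (leqnn k)) ke] := near_infty_natSinv_lt (PosNum e0).
have /existsNP[N /existsNP[_ nN]] :
    ~ lim_sup_set (fun n => [set w | k.+1%:R^-1 <= `|Y n w - l|]) w.
  by move=> h; apply: nlimsup; exists k.
exists N => // n Nn; rewrite distrC (le_lt_trans _ ke)// leNgt.
by apply/negP => /ltW kn; apply: nN; exists n.
Qed.

Lemma as_cvg_of_summable_deviations :
  (forall e : R, (0 < e)%R ->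
    \sum_(0 <= n <oo) P [set w | (e <= `|Y n w - l|)%R] < +oo)%E ->
  P [set w | Y n w @[n --> \oo] --> l] = 1%E.
Proof.
move=> sumY.
pose F k n := [set w | k.+1%:R^-1 <= `|Y n w - l|].
have mF k : measurable (lim_sup_set (F k)).
  apply: bigcap_measurableType => n _; apply: bigcup_measurable => m _.
  exact: measurable_deviation.
rewrite cvg_setE probability_setC; last exact: bigcupT_measurable.
suff -> : P (\bigcup_k lim_sup_set (F k)) = 0%E by rewrite sube0.
apply/negligibleP; first exact: bigcupT_measurable.
apply: negligible_bigcup => k; apply/negligibleP => //.
(* First Borel-Cantelli lemma, at the threshold [1 / (k + 1)]. *)
apply: lim_sup_set_cvg0; first by move=> n; exact: measurable_deviation.
by apply: sumY; rewrite invr_gt0.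
Qed.

Lemma as_cvg_of_inv_sqr_deviations :
  (forall e : R, (0 < e)%R -> exists C : R, \forall n \near \oo,
    P [set w | (e <= `|Y n w - l|)%R] <= (C * n.+1%:R ^- 2)%:E)%E ->
  P [set w | Y n w @[n --> \oo] --> l] = 1%E.
Proof.
move=> PY; apply: as_cvg_of_summable_deviations => e /PY[C [N _ PC]].
(* For [n < N] the entry [N^2] makes the bound at least 1, which any probability satisfies. *)
apply: (@inv_sqr_series_lty _ (Num.max C (N%:R ^+ 2))) => // n.
have n0 : 0 < n.+1%:R ^+ 2 :> R by rewrite exprn_gt0.
have [Nn|nN] := leqP N n.
  by rewrite (le_trans (PC _ Nn))// lee_fin ler_pM2r ?invr_gt0// le_max lexx.
apply: (le_trans (probability_le1 _ (measurable_deviation e n))).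
by rewrite lee_fin ler_pdivlMr// mul1r le_max -!natrX ler_nat leq_exp2r// nN orbT.
Qed.

End almost_sure_convergence.

(** * Exponential moments and tails of sums of independent Bernoulli variables *)

Section chernoff.
Context (d : measure_display) (T : measurableType d) (R : realType).
Context (P : probability T R) (I : choiceType) (D : set I).
Variables (X : I -> {RV P >-> R}) (p : R).
Hypothesis indepX : mutually_independent D X.
Hypothesis bernX : forall i, D i -> bernoulli_RV p (X i).

Let event (J : {fset I}) (B : I -> set R) :=
  \bigcap_(i in [set` J]) (X i @^-1` B i).

Lemma measurable_preimage i (B : set R) : measurable B -> measurable (X i @^-1` B).
Proof. by move=> mB; rewrite -[X in measurable X]setTI; exact: measurable_funP. Qed.

Lemma measurable_event J B :
  (forall i, i \in J -> measurable (B i)) -> measurable (event J B).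
Proof.
move=> mB; apply: fin_bigcap_measurable; first exact: finite_fset.
by move=> i /= iJ; apply: measurable_preimage; exact: mB.
Qed.

Lemma measurable_sum_exp t (s : seq I) (A : set T) :
  measurable_fun A (fun w => expR (t * \sum_(i <- s) X i w)).
Proof.
apply: (@measurable_funS _ _ _ _ setT) => //.
apply: measurableT_comp => //.
by apply: measurable_funM => //; apply: measurable_sum => i; exact: measurable_funP.
Qed.

(** As [j] is fresh, overriding [B] at [j] keeps the constraints on [J]; adding a constraint on
    [X j] thus stays within product events. *)
Lemma event_consE J B j (V : set R) : j \notin J ->
  event (j |` J)%fset (fun i => if i == j then V else B i) =
  event J B `&` X j @^-1` V.
Proof.
move=> jJ; apply/seteqP; split => w /=.
  move=> h; split.
    move=> i /= iJ; have := h i; rewrite /= inE iJ orbT => /(_ isT).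
    by case: eqP => // ij; move: jJ; rewrite -ij iJ.
  by have := h j; rewrite /= !inE eqxx; exact.
move=> [hJ hj] i /=; rewrite !inE => /orP[/eqP ->|iJ]; first by rewrite eqxx.
by case: eqP => [->//|_]; exact: hJ.
Qed.

(** Independence is applied twice, to the index set enlarged by [j] and to [J] itself. *)
Lemma probability_event_cons J B j (V : set R) : j \notin J ->
  D j -> [set` J] `<=` D -> (forall i, i \in J -> measurable (B i)) ->
  measurable V ->
  P (event J B `&` X j @^-1` V) = (P (event J B) * P (X j @^-1` V))%E.
Proof.
move=> jJ Dj JD mB mV; rewrite -event_consE// indepX; last 2 first.
- by move=> i /=; rewrite !inE => /orP[/eqP ->//|/JD].
- by move=> i; rewrite !inE => /orP[/eqP ->|iJ]; [rewrite eqxx|case: ifP => // _; exact: mB].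
rewrite big_fsetU1//= eqxx muleC indepX//; congr (_ * _)%E.
apply: eq_big_seq => i iJ; case: eqP => // ij.
by move: jJ; rewrite -ij iJ.
Qed.

(** [bernoulli_RV] prescribes only two probabilities, so [X i] is 0-1 valued merely almost surely;
    this allows integrals to be split over the two values. *)
Lemma bernoulli_null i : D i ->
  P (~` (X i @^-1` [set 1] `|` X i @^-1` [set 0])) = 0%E.
Proof.
move=> /bernX[P1 P0]; have mX v := measurable_preimage i _ (measurable_set1 (v : R)).
rewrite probability_setC; last exact: measurableU.
rewrite measureU//.
  rewrite [X in (1 - (X + _)%R)%E]P1 [X in (1 - (_ + X)%R)%E]P0.
  by rewrite -EFinD subrKC subrr.
rewrite -subset0 => w /= [-> /eqP]; rewrite oner_eq0//.
Qed.

(* Restricting to the product event [event J B] makes the induction on [s] go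
   through: each step moves one index from [s] to [J]. *)
Lemma integral_expR_sum t (s : seq I) (J : {fset I}) (B : I -> set R) :
  uniq s -> [set` s] `<=` D -> [set` J] `<=` D ->
  (forall i, i \in s -> i \notin J) ->
  (forall i, i \in J -> measurable (B i)) ->
  (\int[P]_(w in event J B) (expR (t * \sum_(i <- s) X i w))%:E =
   P (event J B) * ((1 - p + p * expR t) ^+ size s)%:E)%E.
Proof.
elim: s J B => [|j s ih] J B us sD JD sJ mB.
  under eq_integral do rewrite big_nil mulr0 expR0.
  by rewrite integral_cst ?mul1e ?expr0 ?mule1//; exact: measurable_event.
have Dj : D j by apply: sD; rewrite /= inE eqxx.
have jJ : j \notin J by apply: sJ; rewrite inE eqxx.
have /andP[js us'] := us.
have mE := measurable_event J B mB.
have mX v := measurable_preimage j _ (measurable_set1 (v : R)).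
(* Where [X j = v], the factor [expR (t * v)] is constant; the rest is the induction hypothesis on
   the product event enlarged by [j]. *)
have step v : (\int[P]_(w in event J B `&` X j @^-1` [set v])
      (expR (t * \sum_(i <- j :: s) X i w))%:E =
    (expR (t * v))%:E * (P (event J B) * P (X j @^-1` [set v]) *
      ((1 - p + p * expR t) ^+ size s)%:E))%E.
  transitivity (\int[P]_(w in event J B `&` X j @^-1` [set v])
      ((expR (t * v))%:E * (expR (t * \sum_(i <- s) X i w))%:E))%E.
    apply: eq_integral => w; rewrite inE => -[_ /= Xv].
    by rewrite big_cons Xv mulrDr expRD EFinM.
  rewrite ge0_integralZl; last 4 first.
  - exact: measurableI.
  - by apply/measurable_EFinP; exact: measurable_sum_exp.
  - by move=> w _; rewrite lee_fin expR_ge0.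
  - by rewrite lee_fin expR_ge0.
  congr (_ * _)%E; rewrite -probability_event_cons//.
  rewrite -event_consE// ih//.
  - by move=> i /= si; apply: sD; rewrite /= inE si orbT.
  - by move=> i /=; rewrite !inE => /orP[/eqP ->//|/JD].
  - move=> i si; rewrite !inE negb_or sJ ?inE ?si ?orbT// andbT.
    by apply: contraNneq js => <-.
  - by move=> i; rewrite !inE => /orP[/eqP ->|iJ]; [rewrite eqxx|case: ifP => // _; exact: mB].
have mf A : measurable_fun A (EFin \o (fun w => expR (t * \sum_(i <- j :: s) X i w))).
  by apply/measurable_EFinP; exact: measurable_sum_exp.
have f0 A w : A w -> (0 <= (expR (t * \sum_(i <- j :: s) X i w))%:E)%E.
  by move=> _; rewrite lee_fin expR_ge0.
(* Discarding the null set leaves the disjoint pieces [X j = 1] and [X j = 0]. *)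
rewrite (ge0_negligible_integral _ mE (mf _) (f0 _) (bernoulli_null j Dj)); last first.
  by apply: measurableC; exact: measurableU.
rewrite setDE setCK setIUr ge0_integral_setU; last 5 first.
- exact: measurableI.
- exact: measurableI.
- exact: mf.
- exact: f0.
- apply/disj_set2P; rewrite -subset0 => w /= [[_ ->] [_ /eqP]].
  by rewrite oner_eq0.
have [P1 P0] := bernX _ Dj.
rewrite !step P1 P0 mulr1 mulr0 expR0 mul1e.
have -> : P (event J B) = (fine (P (event J B)))%:E by rewrite fineK// fin_num_measure.
rewrite -!EFinM -EFinD/= exprS; congr (_%:E); ring.
Qed.

(** Exponential Markov inequality. Leaving the sign of [t] free covers both the upper and the lower
    tail. *)
Lemma bernoulli_sum_tail t x (s : seq I) :
  uniq s -> [set` s] `<=` D -> 0 <= p <= 1 ->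
  (P [set w | (x <= t * \sum_(i <- s) X i w)%R] <=
   (expR ((size s)%:R * (p * (expR t - 1)) - x))%:E)%E.
Proof.
move=> us sD /andP[p0 p1].
set A := [set w | _].
have mS := measurable_sum_exp t s.
have mA : measurable A.
  rewrite /A -[X in measurable X]setTI; apply: measurable_fun_le => //.
  by apply: measurable_funM => //; apply: measurable_sum => i; exact: measurable_funP.
have : ((expR x)%:E * P A <= ((1 - p + p * expR t) ^+ size s)%:E)%E.
  have := integral_expR_sum t s fset0 (fun=> setT) us sD.
  rewrite /event set_fset0 bigcap_set0 probability_setT mul1e => <-//.
  rewrite -integral_cst//; apply: (@le_trans _ _
      (\int[P]_(w in A) (expR (t * \sum_(i <- s) X i w))%:E)%E).
    apply: ge0_le_integral => //.
    - by move=> w _; rewrite lee_fin expR_ge0.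
    - by apply/measurable_EFinP; exact: mS.
    - by move=> w Aw; rewrite lee_fin ler_expR.
  apply: ge0_subset_integral => //.
  by apply/measurable_EFinP; exact: mS.
rewrite -lee_pdivlMl ?expR_gt0// => /le_trans; apply.
rewrite -EFinM lee_fin expRD expRN [leRHS]mulrC ler_wpM2l ?invr_ge0 ?expR_ge0//.
(* Factor by factor, [1 + y <= expR y] with [y = p * (expR t - 1)]. *)
rewrite expRM_natl; apply: lerXn2r; rewrite ?nnegrE ?expR_ge0//.
  by rewrite addr_ge0 ?subr_ge0// mulr_ge0 ?expR_ge0.
apply: le_trans (expR_ge1Dx _); lra.
Qed.

End chernoff.

(** * Concentration of the degree of vertex 1 *)

(** Once the zero diagonal entry is dropped, the remaining pairs lie above the diagonal, where
    independence is stated. *)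
Lemma degree1E (d : measure_display) (T : measurableType d) (R : realType)
    (P : probability T R) (n : nat) (p : R) (a : nat -> nat -> {RV P >-> R}) w :
  (0 < n)%N -> erdos_renyi n p a ->
  degree n a 1 w = \sum_(ij <- [seq (1%N, l) | l <- index_iota 2 n.+1])
    a ij.1 ij.2 w.
Proof.
by move=> n0 er; rewrite /degree big_ltn ?ltnS// (er_diag er) ?n0// add0r big_map.
Qed.

Lemma degree_deviation (d : measure_display) (T : measurableType d)
    (R : realType) (P : probability T R) (n : nat) (rho e : R)
    (a : nat -> nat -> {RV P >-> R}) :
  (0 < n)%N -> 0 < rho < n%:R -> 0 < e <= 2 -> erdos_renyi n (rho / n%:R) a ->
  (P [set w | (e <= `|degree n a 1 w / rho - 1|)%R] <=
   (2 * expR (1 - e ^+ 2 / 8 * rho))%:E)%E.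
Proof.
move=> n0 /andP[r0 rn] /andP[e0 e2] er.
have n0R : 0 < n%:R :> R by rewrite ltr0n.
set s := [seq (1%N, l) | l <- index_iota 2 n.+1].
set p := rho / n%:R in er *.
have p0 : 0 < p by rewrite divr_gt0.
have p1 : p < 1 by rewrite ltr_pdivrMr// mul1r.
have np : n%:R * p = rho by rewrite mulrC divfK// gt_eqF.
have us : uniq s by rewrite map_inj_uniq ?iota_uniq// => x y [].
have sD : [set` s] `<=`
    [set ij : nat * nat | [/\ 1 <= ij.1, ij.1 < ij.2 & ij.2 <= n]%N].
  move=> _ /= /mapP[l + ->] /=; rewrite mem_index_iota ltnS => /andP[].
  by move=> l2 ln; split.
have sizes : (size s)%:R = n%:R - 1 :> R.
  by rewrite size_map size_iota subSS natrB.
(* For [t > 0] the event is [degree >= (1 + e) rho], for [t < 0] it is [degree <= (1 - e) rho]. The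
   size [e / 4] minimizes [2 t^2 - |t| e], with value [- e^2 / 8]. *)
have tail t : `|t| = e / 4 ->
    (P [set w | (t * rho + `|t| * e * rho <= t * degree n a 1 w)%R] <=
     (expR (1 - e ^+ 2 / 8 * rho))%:E)%E.
  move=> te.
  under eq_set do rewrite (degree1E _ _ _ _ _ _ _ _ n0 er).
  apply: le_trans (bernoulli_sum_tail _ _ _ P _ _ _ _ (er_indep er) _ t _ _ us sD _) _.
  - by move=> [i j] /= [? ? ?]; exact: (er_bernoulli er).
  - by rewrite !ltW.
  have /ler_normlP[tm tp] : `|t| <= e / 4 by rewrite te.
  have t2 : t ^+ 2 = e ^+ 2 / 16 by rewrite -real_normK ?num_real// te; field.
  have et : expR t - 1 <= t + 2 * t ^+ 2.
    by have := expR_le_quadratic _ t; rewrite t2; lra.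
  rewrite lee_fin ler_expR sizes te.
  have : (n%:R - 1) * (p * (expR t - 1)) <= (n%:R - 1) * (p * (t + 2 * t ^+ 2)).
    by rewrite ler_wpM2l ?subr_ge0 ?ler1n// ler_wpM2l// ltW.
  have -> : (n%:R - 1) * (p * (t + 2 * t ^+ 2)) =
      (n%:R * p) * (t + 2 * t ^+ 2) - p * (t + 2 * t ^+ 2) by ring.
  (* The added 1 absorbs [- p (t + 2 t^2)], due to having [n - 1] summands instead of [n]: here
     [p < 1] and [t >= -1/2]. *)
  rewrite np t2 => /le_trans - /(_ (rho * (t + 2 * (e ^+ 2 / 16)) + 1)) le1.
  rewrite lerBlDr; apply: le_trans (le1 _) _.
    rewrite lerD2l.
    have : 0 <= p * (t + 2^-1) by rewrite mulr_ge0 ?(ltW p0)//; lra.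
    have : 0 <= p * (2 * (e ^+ 2 / 16)).
      by rewrite mulr_ge0 ?(ltW p0)// mulr_ge0// divr_ge0// sqr_ge0.
    lra.
  by rewrite le_eqVlt; apply/orP; left; apply/eqP; field.
have mdeg : measurable_fun setT (degree n a 1).
  by apply: measurable_sum => i; exact: measurable_funP.
have mtail (t : R) : measurable
    [set w | t * rho + `|t| * e * rho <= t * degree n a 1 w].
  rewrite -[X in measurable X]setTI; apply: measurable_fun_le => //.
  exact: measurable_funM.
have e40 : 0 < e / 4 by lra.
have ne4 : `|e / 4| = e / 4 by rewrite gtr0_norm.
have nne4 : `|- (e / 4)| = e / 4 by rewrite normrN gtr0_norm.
apply: (@le_trans _ _ (P ([set w | e / 4 * rho + `|e / 4| * e * rho <=
    e / 4 * degree n a 1 w] `|` [set w | - (e / 4) * rho + `|- (e / 4)| * e * rho <=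
    - (e / 4) * degree n a 1 w]))).
  apply: le_measure; rewrite ?inE.
  - apply: (@measurable_deviation _ _ _ (fun=> fun w => degree n a 1 w / rho) 1 _ e 0%N).
    by move=> _; exact: measurable_funM.
  - exact: measurableU.
  - move=> w /=; rewrite ne4 nne4.
    have -> : degree n a 1 w / rho - 1 = (degree n a 1 w - rho) / rho.
      by field; rewrite gt_eqF.
    rewrite normrM normfV (gtr0_norm r0) ler_pdivlMr// ler_normr => /orP[h|h].
      by left; move: h; rewrite -(ler_pM2l e40); lra.
    by right; move: h; rewrite -(ler_pM2l e40); lra.
apply: (le_trans (measureU2 _ _ _)) => //.
rewrite mulr_natl mulr2n EFinD; apply: leeD; exact: tail.
Qed.

Theorem theorem3p2 (d : measure_display) (T : measurableType d) (R : realType)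
    (P : probability T R) (rho chi : nat -> R)
    (a : nat -> nat -> nat -> {RV P >-> R})
    (hrho : \forall n \near \oo, rho n = chi n * ln (n%:R : R))
    (hrho_bd : \forall n \near \oo, 0 < rho n < n%:R)
    (hchi : chi n @[n --> \oo] --> +oo)
    (ha : \forall n \near \oo, erdos_renyi n (rho n / n%:R) (a n)) :
  P [set w | degree n (a n) 1%N w / rho n @[n --> \oo] --> (1 : R)] = 1%E.
Proof.
apply: (as_cvg_of_inv_sqr_deviations _ _ _ _ (fun n w => degree n (a n) 1 w / rho n)).
  move=> n; apply: measurable_funM => //.
  by apply: measurable_sum => i; exact: measurable_funP.
(* Capping [e] meets the bound [e <= 2] of [degree_deviation] and only enlarges the deviation
   event. *)
move=> e0 e0_gt0; pose e := Num.min e0 1.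
have e_gt0 : 0 < e by rewrite lt_min e0_gt0 ltr01.
have e_le1 : e <= 1 by rewrite ge_min lexx orbT.
have ee0 : e <= e0 by rewrite ge_min lexx.
have mdev (x : R) n : measurable [set w | x <= `|degree n (a n) 1 w / rho n - 1|].
  apply: (measurable_deviation _ _ _ (fun n w => degree n (a n) 1 w / rho n)).
  move=> k; apply: measurable_funM => //.
  by apply: measurable_sum => i; exact: measurable_funP.
(* The tail is at most [2 expR (1 - 2 ln n) = 2 expR 1 / n^2], and [n + 1 <= 2 n] costs a factor
   4. *)
exists (8 * expR 1); near=> n.
have n0 : (0 < n)%N by near: n; exact: nbhs_infty_gt.
have n0R : 0 < n%:R :> R by rewrite ltr0n.
have n1R : 1 <= n%:R :> R by rewrite ler1n.
have er : erdos_renyi n (rho n / n%:R) (a n) by near: n.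
have rbd : 0 < rho n < n%:R by near: n.
have rE : rho n = chi n * ln n%:R by near: n.
(* Chosen so that [e^2 / 8 * rho n >= 2 ln n]. *)
have chi_ge : 16 / e ^+ 2 <= chi n by near: n; exact: cvgry_ge.
apply: (@le_trans _ _ (P [set w | e <= `|degree n (a n) 1 w / rho n - 1|])).
  by apply: le_measure; rewrite ?inE// => w /=; exact: le_trans.
apply: le_trans (degree_deviation _ _ _ _ _ _ _ _ n0 rbd _ er) _.
  by rewrite e_gt0/=; lra.
have ln0 : 0 <= ln (n%:R : R) by rewrite ln_ge0.
have e2 : 0 < e ^+ 2 by rewrite exprn_gt0.
have : 2 * ln n%:R <= e ^+ 2 / 8 * rho n.
  rewrite rE mulrA ler_wpM2r//.
  have -> : 2 = e ^+ 2 / 8 * (16 / e ^+ 2) :> R by field; rewrite gt_eqF.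
  by rewrite ler_wpM2l// divr_ge0// ltW.
move=> le2; rewrite lee_fin.
apply: (@le_trans _ _ (2 * expR (1 - 2 * ln n%:R))).
  by rewrite ler_wpM2l// ler_expR lerB.
rewrite expRD expRN expRM_natl lnK ?posrE//.
have -> : 8 * expR 1 / n.+1%:R ^+ 2 = 2 * (expR 1 * (4 / n.+1%:R ^+ 2)) :> R by ring.
rewrite ler_pM2l// ler_pM2l ?expR_gt0// ler_pdivlMr ?exprn_gt0//.
rewrite mulrC ler_pdivrMr ?exprn_gt0// -natr1.
have -> : 4 * n%:R ^+ 2 = (2 * n%:R) ^+ 2 :> R by ring.
by rewrite lerXn2r ?nnegrE//; lra.
Unshelve. all: by end_near.
Qed.
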